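(* Let $X$ be a locally compact completely regular ($\mathrm{T}_{3\frac12}$) topological space, let $v:X\to[0,\infty)$ be a weight function, and let $A=\{a_1,\dots,a_N\}\subset C^0_v$ be a finite set of functions which contains a nonzero constant, separates points and tends to infinity at infinity. Suppose also that for some constants $C,c'>0$ $$v(x)\le C\exp(-c'|a_j(x)|)\quad\text{for all }x\in X\text{ and all }j=1,\dots,N.$$ Then the algebra of polynomials in $a_j(x)$ and $\overline{a_j(x)}$, $j=1,\dots,N$, is dense in $C^0_v$.
   Context: All function spaces may consist either of real-valued functions (with real polynomials) or of complex-valued functions (with complex polynomials); the statement covers both cases. $C(X)$ is the space of continuous functions on $X$. A function $f$ on $X$ is said to tend to $0$ at infinity if for every $\epsilon>0$ the set $\{x\in X:|f(x)|\ge\epsilon\}$ is compact. A function $f$ tends to infinity at infinity if for every $R>0$ the set $\{x\in X:|f(x)|\le R\}$ is compact. For a weight function $v\ge0$ on $X$, $C^0_v$ is the space of functions $f\in C(X)$ such that $v(x)f(x)\to0$ at infinity, with the norm $|f|_v=\sup_{x\in X}|f(x)|v(x)$ (a seminorm if $v$ has zeros); density is with respect to it. A system $A=\{a_1,\dots,a_N\}$ separates points if for any two different points $x,x'\in X$ there is $j$ with $a_j(x)\ne a_j(x')$. The system $A$ tends to infinity at infinity if the function $\sum_j|a_j(x)|$ tends to infinity at infinity. *)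

(* Defs.v *)
From HB Require Import structures.
From mathcomp Require Import all_boot all_order all_algebra.
From mathcomp Require Import all_classical all_reals all_analysis.
From mathcomp Require Import complex.
(* Not imported: the notations of mpoly clash with those of mathcomp-analysis. *)
From mathcomp Require mpoly.

Set Implicit Arguments.
Unset Strict Implicit.
Unset Printing Implicit Defensive.

Import Order.TTheory GRing.Theory Num.Theory.
Import numFieldNormedType.Exports.

Local Open Scope classical_set_scope.
Local Open Scope ring_scope.

Variant scalar_kind := RealScalars | ComplexScalars.

Definition scalar_field (R : realType) (k : scalar_kind) : numFieldType :=
  match k with
  | RealScalars => R
  | ComplexScalars => R[i]
  end.

(* The norm of R[i] as a numFieldType takes its values in R[i]; the modulus
   is needed in R, to be compared with the weight and used under expR. *)
Definition modulus (R : realType) (k : scalar_kind) : scalar_field R k -> R :=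
  match k with
  | RealScalars => fun z : R => `|z|
  | ComplexScalars => fun z : R[i] => ComplexField.Normc.normc z
  end.

Definition conjugate (R : realType) (k : scalar_kind) :
    scalar_field R k -> scalar_field R k :=
  match k with
  | RealScalars => fun z : R => z
  | ComplexScalars => fun z : R[i] => conjc z
  end.

Section WeightedSpace.
Variables (R : realType) (k : scalar_kind) (X : topologicalType).
Local Notation K := (scalar_field R k).

Definition tends_to_zero_at_infinity (f : X -> R) : Prop :=
  forall eps : R, 0 < eps -> compact [set x | eps <= `|f x|].

Definition tends_to_infinity_at_infinity (f : X -> R) : Prop :=
  forall r : R, 0 < r -> compact [set x | `|f x| <= r].

(* Convergence to 0 only involves absolute values, so v f is replaced by the
   real-valued v |f|. *)
Definition C0 (v : X -> R) : set (X -> K) :=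
  [set f | continuous f /\
           tends_to_zero_at_infinity (fun x => v x * modulus (f x))].

(* Extended-real supremum: the real-valued sup would be 0 on an unbounded set. *)
Definition weighted_norm (v : X -> R) (f : X -> K) : \bar R :=
  ereal_sup (range (fun x => (modulus (f x) * v x)%:E)).

Definition dense_in_C0 (v : X -> R) (D : set (X -> K)) : Prop :=
  D `<=` C0 v /\
  forall f : X -> K, C0 v f -> forall eps : R, 0 < eps ->
    exists2 g : X -> K, D g & (weighted_norm v (f \- g)%R < eps%:E)%E.

Variables (N : nat) (a : 'I_N -> X -> K).

Definition separates_points : Prop :=
  forall x y : X, x <> y -> exists j : 'I_N, a j x <> a j y.

Definition system_tends_to_infinity : Prop :=
  tends_to_infinity_at_infinity (fun x => \sum_(j < N) modulus (a j x)).

(* The first N indeterminates stand for the a_j, the last N for their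
   conjugates. *)
Definition system_valuation (x : X) (i : 'I_(N + N)) : K :=
  match fintype.split i with
  | inl j => a j x
  | inr j => conjugate (a j x)
  end.

Definition polynomial_algebra : set (X -> K) :=
  range (fun (p : mpoly.mpoly (N + N) K) (x : X) =>
           mpoly.meval (system_valuation x) p).

End WeightedSpace.

(* Main.v *)
Require Import Defs.
From mathcomp Require Import all_boot all_order all_algebra.
From mathcomp Require Import all_classical all_reals all_analysis.
From mathcomp Require Import complex ring lra.
From mathcomp Require Import (canonicals) mpoly.

Set Implicit Arguments.
Unset Strict Implicit.
Unset Printing Implicit Defensive.

Import Order.TTheory GRing.Theory Num.Theory.
Import numFieldNormedType.Exports.

Local Open Scope classical_set_scope.
Local Open Scope ring_scope.

(** Write [B] for the sum of the [|a_j|]. Bounding [v] at each point by means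
    of the largest [|a_j|] gives [v <= C exp(-c B)] with [c = c' / N], while
    every polynomial in the [a_j] and their conjugates grows more slowly than
    [exp(e B)] for every [e > 0]. Since one of the [a_j] is a nonzero constant,
    the sets [v >= e] are compact, so [v] is upper semicontinuous and vanishes
    at infinity; this gives the inclusion of the polynomials in the weighted
    space ([polynomial_algebra_C0]).

    Density is first proved for real-valued functions ([weighted_density]) and
    then applied to the real and imaginary parts. Let [P] be the algebra of
    real-valued polynomials and let [M] be the set of bounded continuous
    functions [h] such that [h q] is a weighted limit of elements of [P] for
    every [q] in [P]. Two facts make [M] useful.
    - It is a uniformly closed algebra: [f (g q)] is approximated by replacing
      [g q] by some [p] in [P], at a cost controlled by the bound on [f], and
      then [f p] by an element of [P] ([multipliers_algebra]).
    - It contains [sin (s b)] for every real or imaginary part [b] of an [a_j]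
      and every small [s > 0]: the Taylor polynomials of order [m] miss the
      sine by at most [2^-m exp(2 s |b|)], which the decay of [v] absorbs as
      soon as [4 s <= c] ([multipliers_sin]).
    Such sines separate the points of [X]. The smallness of [s] is harmless
    because [M] is an algebra, so no analytic continuation in [s] has to be
    made.

    A given [f] in the weighted space is bounded on the compact set where
    [v |f| >= e], so up to [e] it may be replaced by its truncation to some
    [[-n, n]]. The truncated function is approximated by the Stone-Weierstrass
    theorem on the compact set where [v] is not small, by an element of [M]
    with values in [[-n, n]]; elsewhere both functions are bounded by [n] and
    [v] is small. Elements of [M] are themselves weighted limits of
    polynomials, as [1] belongs to [P]. *)

(** * The Stone-Weierstrass theorem on a compact subset *)

(** If [Q K] failed, the sets [B] with [Q (K `\` B)] would form a proper filter
    containing [K]; a cluster point of it in [K] contradicts [Q] being true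
    near that point. *)
Lemma compact_ind (T : topologicalType) (K : set T) (Q : set T -> Prop) :
  compact K -> Q set0 ->
  (forall A B, Q A -> Q B -> Q (A `|` B)) ->
  (forall A B, A `<=` B -> Q B -> Q A) ->
  (forall x, K x -> exists2 U, nbhs x U & Q U) -> Q K.
Proof.
move=> cK Q0 QU QS Qloc; apply: contrapT => nQK.
pose F : set_system T := fun B => Q (K `\` B).
have FF : Filter F.
  split => [|A B FA FB|A B AB FA].
  - by rewrite /F setDT.
  - by rewrite /F setDIr; exact: QU.
  - by apply: QS FA; exact: setDS.
have PF : ProperFilter F by split => //; rewrite /F setD0.
have FK : F K by rewrite /F setDv.
have [x [Kx clx]] := cK F PF FK.
have [U xU QU'] := Qloc x Kx.
have FU : F (~` U).
  by apply: QS QU' => y [_] /contrapT.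
by have [y [] ] := clx _ _ FU xU.
Qed.

Section UniformlyClosedAlgebra.
Variables (R : realType) (X : Type).

Record uniformly_closed_algebra (S : set (X -> R)) : Prop := {
  uca_cst : forall c, S (fun=> c);
  uca_add : forall f g, S f -> S g -> S (fun x => f x + g x);
  uca_mul : forall f g, S f -> S g -> S (fun x => f x * g x);
  uca_bounded : forall f, S f -> exists b, forall x, `|f x| <= b;
  uca_limit : forall f, (forall e, 0 < e ->
    exists2 g, S g & forall x, `|f x - g x| <= e) -> S f }.

(** The iteration [s := s + (t ^+ 2 - s ^+ 2) / 2] approximates the square root
    of [t ^+ 2] by polynomials in [t]. *)
Fixpoint abs_iter (t : R) (k : nat) : R :=
  if k is k'.+1 then abs_iter t k' + (t ^+ 2 - abs_iter t k' ^+ 2) / 2 else 0.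

(** One step multiplies the error [`|t| - s] by [1 - (`|t| + s) / 2], which is
    at most [1 - `|t| / 2]; so the error is at most [`|t| * (1 - `|t| / 2) ^+ k],
    and Bernoulli's inequality, in the inductive form of the third conjunct,
    makes this uniformly small in [t]. *)
Lemma abs_iter_bounds (t : R) (k : nat) : `|t| <= 1 ->
  [/\ 0 <= abs_iter t k, abs_iter t k <= `|t| &
      (`|t| - abs_iter t k) * (1 + k%:R * (`|t| / 2)) <= `|t|].
Proof.
move=> t1; have t0 := normr_ge0 t.
elim: k => [|k [s0 st dk]] /=; first by split => //; lra.
rewrite -real_normK ?num_real//.
set s := abs_iter t k in s0 st dk *; set y : R := `|t| in t0 t1 st dk *.
have -> : s + (y ^+ 2 - s ^+ 2) / 2 = y - (y - s) * (1 - (y + s) / 2) by field.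
have k0 : 0 <= k%:R :> R by [].
rewrite -[k.+1%:R]natr1; move: (k%:R : R) k0 dk => m m0 dk.
have ds : 0 <= y - s by lra.
have le1 : 0 <= (y - s) * (1 - (y + s) / 2) by apply: mulr_ge0 => //; lra.
have le2 : (y - s) * (1 - (y + s) / 2) <= (y - s) * (1 - y / 2).
  by apply: ler_wpM2l => //; lra.
have le3 : (y - s) * (1 - y / 2) <= y - s by rewrite ler_piMr//; lra.
split.
- by apply: (le_trans _ (lerB (lexx y) (le_trans le2 le3))); lra.
- by rewrite lerBlDr lerDl.
rewrite subKr.
have y20 : 0 <= y / 2 by rewrite divr_ge0.
have m1 : 0 <= 1 + (m + 1) * (y / 2).
  by rewrite addr_ge0// mulr_ge0// addr_ge0.
apply: (le_trans (ler_wpM2r m1 le2)).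
apply: le_trans dk; rewrite -mulrA; apply: ler_wpM2l => //.
have -> : (1 - y / 2) * (1 + (m + 1) * (y / 2)) =
  1 + m * (y / 2) - (m + 1) * (y / 2) ^+ 2 by ring.
by rewrite lerBlDr lerDl mulr_ge0 ?exprn_ge0// addr_ge0.
Qed.

Lemma abs_iter_cvg (t : R) (k : nat) : `|t| <= 1 ->
  `| `|t| - abs_iter t k| * k%:R <= 2.
Proof.
move=> t1; have [s0 st dk] := abs_iter_bounds k t1.
have t0 := normr_ge0 t; have k0 : 0 <= k%:R :> R by [].
rewrite ger0_norm ?subr_ge0//.
have [t_eq0|tn0] := eqVneq `|t| 0.
  have -> : `|t| - abs_iter t k = 0 by lra.
  by rewrite mul0r.
have tp : 0 < `|t| by rewrite lt_def tn0.
rewrite -(ler_pM2r tp).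
nra.
Qed.

Variable S : set (X -> R).
Hypothesis algS : uniformly_closed_algebra S.

Lemma uca_abs f : S f -> S (fun x => `|f x|).
Proof.
move=> Sf; have [b0 fb0] := uca_bounded algS Sf.
pose b := `|b0| + 1; have bp : 0 < b by rewrite /b; have := normr_ge0 b0; lra.
have fb x : `|f x / b| <= 1.
  rewrite normrM normfV (gtr0_norm bp) ler_pdivrMr// mul1r.
  by apply: (le_trans (fb0 x)); rewrite /b; have := ler_norm b0; lra.
have Sit k : S (fun x => abs_iter (f x / b) k).
  elim: k => [|k IH] /=; first exact: (uca_cst algS).
  have -> : (fun x => abs_iter (f x / b) k +
      ((f x / b) ^+ 2 - abs_iter (f x / b) k ^+ 2) / 2) =
    (fun x => abs_iter (f x / b) k + ((f x * f x) * (b ^- 2 / 2) +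
       (abs_iter (f x / b) k * abs_iter (f x / b) k) * - 2^-1)).
    by apply/funext => x; field; rewrite gt_eqF.
  by do !(apply: (uca_add algS) || apply: (uca_mul algS) => //
          || exact: (uca_cst algS)).
apply: (uca_limit algS) => e ep.
pose k := (Num.truncn (2 * b / e)).+1.
have kp : 2 * b / e < k%:R by exact: truncnS_gt.
exists (fun x => b * abs_iter (f x / b) k) => [|x].
  by apply: (uca_mul algS) => //; exact: (uca_cst algS).
have -> : `|f x| - b * abs_iter (f x / b) k =
    b * (`|f x / b| - abs_iter (f x / b) k).
  rewrite normrM normfV (gtr0_norm bp); field; by rewrite gt_eqF.
rewrite normrM (gtr0_norm bp).
have k0 : 0 < k%:R :> R by rewrite ltr0n.
have := abs_iter_cvg k (fb x).
rewrite ltr_pdivrMr// in kp.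
set d := `|_|; rewrite -(ler_pM2r k0) => dk.
nra.
Qed.

Lemma uca_max f g : S f -> S g -> S (fun x => Num.max (f x) (g x)).
Proof.
move=> Sf Sg.
have -> : (fun x => Num.max (f x) (g x)) =
    (fun x => (f x + g x + `|f x + -1 * g x|) * 2^-1).
  apply/funext => x; rewrite mulN1r.
  by case: (lerP (f x) (g x)) => fg; lra.
apply: (uca_mul algS); last exact: (uca_cst algS).
apply: (uca_add algS); first exact: (uca_add algS).
apply: (@uca_abs (fun x => f x + -1 * g x)).
apply: (uca_add algS) => //; apply: (uca_mul algS) => //.
exact: (uca_cst algS).
Qed.

Lemma uca_min f g : S f -> S g -> S (fun x => Num.min (f x) (g x)).
Proof.
move=> Sf Sg.
have -> : (fun x => Num.min (f x) (g x)) =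
    (fun x => f x + g x + -1 * Num.max (f x) (g x)).
  by apply/funext => x; case: (lerP (f x) (g x)) => fg; lra.
apply: (uca_add algS); first exact: (uca_add algS).
apply: (uca_mul algS); first exact: (uca_cst algS).
exact: uca_max.
Qed.

Lemma uca_interpolation f :
  (forall x y, x <> y -> exists2 h, S h & h x <> h y) ->
  forall x y, exists g, [/\ S g, g x = f x & g y = f y].
Proof.
move=> sep x y; have [->|xy] := pselect (x = y).
  by exists (fun=> f y); split => //; exact: (uca_cst algS).
have [h Sh /eqP hxy] := sep x y xy.
exists (fun z => f x + (f y - f x) / (h y - h x) * (h z + - h x)).
split.
- apply: (uca_add algS); first exact: (uca_cst algS).
  apply: (uca_mul algS); first exact: (uca_cst algS).
  by apply: (uca_add algS) => //; exact: (uca_cst algS).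
- by rewrite subrr mulr0 addr0.
- by rewrite divfK ?subr_eq0 1?eq_sym// addrC subrK.
Qed.

End UniformlyClosedAlgebra.

(** Lattice proof: [S] is closed under [max] and [min] because it is closed under
    absolute values. Interpolating [f] at two points and taking maxima over a
    finite cover of [K] gives, for each [y], a [g] above [f - d] on [K] equal
    to [f] at [y]; minima of such [g] over a second finite cover are also below
    [f + d]. Truncation to [[-n, n]] only brings [g] closer to [f]; it provides
    the bound away from [K], where nothing else controls [g]. *)
Lemma stone_weierstrass (R : realType) (X : topologicalType)
    (S : set (X -> R)) (f : X -> R) (n d : R) (K : set X) :
  uniformly_closed_algebra S -> (forall g, S g -> continuous g) ->
  (forall x y, x <> y -> exists2 h, S h & h x <> h y) ->
  continuous f -> (forall x, `|f x| <= n) -> compact K -> 0 < d ->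
  exists g, [/\ S g, forall x, `|g x| <= n & forall x, K x -> `|f x - g x| <= d].
Proof.
move=> algS Sc sep fc fn cK dp.
have lower y : exists g, [/\ S g, g y = f y & forall x, K x -> f x - d < g x].
  apply: (compact_ind (Q := fun A => exists g,
    [/\ S g, g y = f y & forall x, A x -> f x - d < g x])) cK _ _ _ _.
  - by exists (fun=> f y); split => //; exact: (uca_cst algS).
  - move=> A B [g [Sg gy gA]] [h [Sh hy hB]].
    exists (fun x => Num.max (g x) (h x)); split; first exact: uca_max.
      by rewrite gy hy maxxx.
    by move=> x [/gA|/hB] xd; rewrite lt_max xd ?orbT.
  - by move=> A B AB [g [Sg gy gB]]; exists g; split => // x /AB /gB.
  - move=> x Kx; have [g [Sg gx gy]] := uca_interpolation algS f sep x y.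
    exists [set z | f z - d < g z]; last by exists g; split.
    have : (fun z => g z - f z) @ x --> g x - f x.
      by apply: cvgB; [exact: (Sc _ Sg)|exact: fc].
    rewrite gx subrr => /cvgrPdist_lt /(_ d dp); apply: filterS => z /=.
    by rewrite sub0r normrN ltr_norml => /andP[+ _]; lra.
have [g [Sg gl gu]] : exists g, [/\ S g, forall x, K x -> f x - d < g x &
    forall x, K x -> g x < f x + d].
  apply: (compact_ind (Q := fun A => exists g, [/\ S g,
    forall x, K x -> f x - d < g x & forall x, A x -> g x < f x + d])) cK _ _ _ _.
  - exists (fun=> n); split => //; first exact: (uca_cst algS).
    by move=> x _; have := ler_normlW (fn x); lra.
  - move=> A B [g [Sg gK gA]] [h [Sh hK hB]].
    exists (fun x => Num.min (g x) (h x)); split; first exact: uca_min.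
      by move=> x Kx; rewrite lt_min gK// hK.
    by move=> x [/gA|/hB] xd; rewrite gt_min xd ?orbT.
  - by move=> A B AB [g [Sg gK gB]]; exists g; split => // x /AB /gB.
  - move=> y Ky; have [g [Sg gy gK]] := lower y.
    exists [set z | g z < f z + d]; last by exists g; split.
    have : (fun z => g z - f z) @ y --> g y - f y.
      by apply: cvgB; [exact: (Sc _ Sg)|exact: fc].
    rewrite gy subrr => /cvgrPdist_lt /(_ d dp); apply: filterS => z /=.
    by rewrite sub0r normrN ltr_norml => /andP[_]; lra.
exists (fun x => Num.max (- n) (Num.min n (g x))); split.
- apply: uca_max => //; first exact: (uca_cst algS).
  by apply: uca_min => //; exact: (uca_cst algS).
- move=> x; have n0 : 0 <= n := le_trans (normr_ge0 _) (fn x).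
  by rewrite ler_norml le_max lexx ge_max ge_min lexx /= andbT; lra.
- move=> x Kx; have := gl x Kx; have := gu x Kx; have := fn x.
  rewrite !ler_norml => /andP[f1 f2] g1 g2.
  by case: (leP n (g x)) => ?; case: (leP (- n) _) => ?; lra.
Qed.

(** * Polynomial approximation of the sine *)

Section SineTaylor.
Variable R : realType.

Lemma sin_coeff_le (x : R) (i : nat) : `|sin_coeff x i| <= exp_coeff `|x| i.
Proof.
rewrite /sin_coeff /exp_coeff /= !normrM normfV normrX normrN1 expr1n.
rewrite (ger0_norm (ler0n _ _)) normrX normr_nat mulr1.
rewrite ler_pM// ?invr_ge0//.
by case: odd; rewrite ?mul1r ?mul0r ?exprn_ge0.
Qed.

(** The tail of the exponential series at [|x|] from the index [m] on is at most
    [2 ^- m] times that of the series at [2 |x|]. *)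
Lemma sin_taylor_remainder (m : nat) (x : R) :
  `|sin x - series (sin_coeff x) m| <= expR (2 * `|x|) / 2 ^+ m.
Proof.
have ex_cvg := @is_cvg_series_exp_coeff R (2 * `|x|).
have partial k : (m <= k)%N -> `|series (sin_coeff x) k - series (sin_coeff x) m|
    <= expR (2 * `|x|) / 2 ^+ m.
  move=> mk; rewrite sub_series_geq//.
  apply: (le_trans (ler_norm_sum _ _ _)).
  have term i : (m <= i)%N ->
      `|sin_coeff x i| <= exp_coeff (2 * `|x|) i / 2 ^+ m.
    move=> mi; apply: (le_trans (sin_coeff_le x i)).
    rewrite /exp_coeff /= exprMn.
    rewrite [leRHS](_ : _ = (2 ^+ i / 2 ^+ m) * (`|x| ^+ i / i`!%:R)); last by ring.
    rewrite ler_peMl// ?mulr_ge0 ?exprn_ge0 ?invr_ge0//.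
    by rewrite ler_pdivlMr ?exprn_gt0// mul1r ler_weXn2l// ler1n.
  rewrite (@le_trans _ _ (\sum_(m <= i < k) exp_coeff (2 * `|x|) i / 2 ^+ m))//.
    by rewrite big_nat_cond [leRHS]big_nat_cond; apply: ler_sum => i /andP[/andP[/term]].
  rewrite -mulr_suml ler_wpM2r ?invr_ge0 ?exprn_ge0//.
  apply: (@le_trans _ _ (series (exp_coeff (2 * `|x|)) k)).
    rewrite /series /= (big_cat_nat (leq0n m) mk)/= lerDr sumr_ge0// => i _.
    by rewrite exp_coeff_ge0// mulr_ge0.
  apply: nondecreasing_cvgn_le => //.
  by apply: nondecreasing_series => i _ _; rewrite exp_coeff_ge0// mulr_ge0.
have sc : series (sin_coeff x) @ \oo --> sin x.
  by rewrite unlock; exact: is_cvg_series_sin_coeff.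
have : (fun k => `|series (sin_coeff x) k - series (sin_coeff x) m|) @ \oo -->
    `|sin x - series (sin_coeff x) m|.
  by apply: cvg_norm; apply: cvgB => //; exact: cvg_cst.
move=> lim_norm; rewrite -(cvg_lim _ lim_norm)//; apply: limr_le.
  by apply/cvg_ex; eexists; exact: lim_norm.
near=> k; apply: partial.
by near: k; exact: nbhs_infty_ge.
Unshelve. all: by end_near. Qed.

End SineTaylor.

(** * Density for real-valued functions *)

Section WeightedApproximation.
Variables (R : realType) (X : topologicalType) (v : X -> R).
Hypothesis v_ge0 : forall x, 0 <= v x.

Record subalgebra (P : set (X -> R)) : Prop := {
  subalgebra_cst : forall c, P (fun=> c);
  subalgebra_add : forall f g, P f -> P g -> P (fun x => f x + g x);
  subalgebra_mul : forall f g, P f -> P g -> P (fun x => f x * g x) }.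

Variable P : set (X -> R).
Hypothesis algP : subalgebra P.

Definition weighted_closure : set (X -> R) :=
  [set h : X -> R | forall e : R, 0 < e ->
    exists2 p, P p & forall x, `|h x - p x| * v x <= e].

(** Boundedness is part of the definition so that a product of two multipliers
    is again one: an error made on [g q] may then be multiplied by [f]. *)
Definition multipliers : set (X -> R) :=
  [set h : X -> R | [/\ continuous h, exists b, forall x, `|h x| <= b &
    forall q, P q -> weighted_closure (fun x => h x * q x)]].

Lemma weighted_closure_sub : P `<=` weighted_closure.
Proof.
by move=> p Pp e e0; exists p => // x; rewrite subrr normr0 mul0r ltW.
Qed.

Lemma weighted_closure_limit h :
  (forall e : R, 0 < e ->
    exists2 g, weighted_closure g & forall x, `|h x - g x| * v x <= e) ->
  weighted_closure h.
Proof.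
move=> hl e e0; have e20 : 0 < e / 2 by rewrite divr_gt0.
have [g /(_ _ e20)[p Pp gp] hg] := hl _ e20.
exists p => // x; have := gp x; have := hg x.
have := ler_distD (g x) (h x) (p x) => /(ler_wpM2r (v_ge0 x)).
rewrite mulrDl; lra.
Qed.

Lemma weighted_closure_add f g : weighted_closure f -> weighted_closure g ->
  weighted_closure (fun x => f x + g x).
Proof.
move=> cf cg e e0; have e20 : 0 < e / 2 by rewrite divr_gt0.
have [p Pp fp] := cf _ e20; have [q Pq gq] := cg _ e20.
exists (fun x => p x + q x) => [|x]; first exact: subalgebra_add.
rewrite opprD addrACA; have := fp x; have := gq x.
have := ler_wpM2r (v_ge0 x) (ler_normD (f x - p x) (g x - q x)).
rewrite mulrDl; lra.
Qed.

Hypothesis P_weighted : forall q, P q -> exists b, forall x, `|q x| * v x <= b.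

Lemma multipliers_algebra : uniformly_closed_algebra multipliers.
Proof.
split.
- move=> c; split; first by move=> x; exact: cvg_cst.
    by exists `|c|.
  move=> q Pq; apply: weighted_closure_sub; apply: subalgebra_mul => //.
  exact: subalgebra_cst.
- move=> f g [fc [b fb] fM] [gc [b' gb] gM]; split.
  + by move=> x; apply: cvgD; [exact: fc|exact: gc].
  + exists (b + b') => x; apply: (le_trans (ler_normD _ _)).
    by have := fb x; have := gb x; lra.
  + move=> q Pq; under eq_fun do rewrite mulrDl.
    by apply: weighted_closure_add; [exact: fM|exact: gM].
- move=> f g [fc [b fb] fM] [gc [b' gb] gM]; split.
  + by move=> x; apply: cvgM; [exact: fc|exact: gc].
  + by exists (b * b') => x; rewrite normrM ler_pM.
  + move=> q Pq; apply: weighted_closure_limit => e e0.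
    pose d := `|b| + 1; have d0 : 0 < d by rewrite ltr_wpDl.
    have [p Pp gp] := gM q Pq (e / d) (divr_gt0 e0 d0).
    exists (fun x => f x * p x) => [|x]; first exact: fM.
    rewrite -mulrA -mulrBr normrM -mulrA.
    have fd : `|f x| <= d.
      by apply: (le_trans (fb x)); rewrite /d; have := ler_norm b; lra.
    apply: (le_trans (ler_pM _ _ fd (gp x))) => //; first by rewrite mulr_ge0.
    by rewrite mulrCA divff ?mulr1// gt_eqF.
- by move=> f [].
- move=> f fl; split.
  + move=> x; apply/cvgrPdist_le => e e0.
    have e30 : 0 < e / 3 by rewrite divr_gt0.
    have [g [gc _ _] fg] := fl _ e30.
    have /cvgrPdist_le /(_ _ e30) := gc x.
    apply: filterS => z gz; have := fg x; have := fg z.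
    have := ler_distD (g x) (f x) (f z); have := ler_distD (g z) (g x) (f z).
    by rewrite [`|g z - f z|]distrC; lra.
  + have [g [_ [b gb] _] fg] := fl 1 ltr01.
    exists (b + 1) => x; have := fg x; have := gb x.
    by have := ler_normD (g x) (f x - g x); rewrite addrC subrK; lra.
  + move=> q Pq; apply: weighted_closure_limit => e e0.
    have [b qb] := P_weighted Pq.
    pose d := `|b| + 1; have d0 : 0 < d by rewrite ltr_wpDl.
    have [g [_ _ gM] fg] := fl (e / d) (divr_gt0 e0 d0).
    exists (fun x => g x * q x) => [|x]; first exact: gM.
    rewrite -mulrBl normrM -mulrA.
    have qd : `|q x| * v x <= d.
      by apply: (le_trans (qb x)); rewrite /d; have := ler_norm b; lra.
    apply: (le_trans (ler_pM _ _ (fg x) qd)) => //; first by rewrite mulr_ge0.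
    by rewrite divfK ?gt_eqF.
Qed.

Variables (B : X -> R) (C c : R).
Hypothesis c_gt0 : 0 < c.
Hypothesis v_le : forall x, v x <= C * expR (- (c * B x)).
Hypothesis P_subexp : forall q, P q -> forall e : R, 0 < e ->
  exists b, forall x, `|q x| <= b * expR (e * B x).

Lemma subalgebra_sum (I : Type) (r : seq I) (F : I -> X -> R) :
  (forall i, P (F i)) -> P (fun x => \sum_(i <- r) F i x).
Proof.
move=> PF; elim: r => [|i r IH].
  by under eq_fun do rewrite big_nil; exact: subalgebra_cst.
by under eq_fun do rewrite big_cons; exact: subalgebra_add.
Qed.

Lemma subalgebra_exp f n : P f -> P (fun x => f x ^+ n).
Proof.
move=> Pf; elim: n => [|n IH]; first exact: subalgebra_cst.
by under eq_fun do rewrite exprS; exact: subalgebra_mul.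
Qed.

(** Half of the decay rate [c] pays for the growth of [q], the other half for
    that of the Taylor remainder, [exp(2 s |b|)] with [2 s <= c / 2]. *)
Lemma multipliers_sin (b : X -> R) (s : R) :
  P b -> continuous b -> (forall x, `|b x| <= B x) -> 0 < s -> 4 * s <= c ->
  multipliers (fun x => sin (s * b x)).
Proof.
move=> Pb bc bB s0 sc; split.
- move=> x; apply: (@continuous_comp _ _ _ (fun x => s * b x) (@sin R)).
    by apply: cvgM; [exact: cvg_cst|exact: bc].
  exact: continuous_sin.
- by exists 1 => x; exact: sin_max.
move=> q Pq; apply: weighted_closure_limit => e e0.
have [D qD] := P_subexp Pq (divr_gt0 c_gt0 (ltr0Sn R 1)).
pose m := (Num.truncn (`|D| * `|C| / e)).+1.
exists (fun x => series (sin_coeff (s * b x)) m * q x).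
  apply: weighted_closure_sub; apply: subalgebra_mul => //.
  rewrite /series /=; apply: subalgebra_sum => i.
  rewrite /sin_coeff /=.
  under eq_fun do rewrite exprMn mulrAC mulrA.
  apply: subalgebra_mul => //; last exact: subalgebra_exp.
  exact: subalgebra_cst.
move=> x; rewrite -mulrBl normrM.
have le1 := sin_taylor_remainder m (s * b x).
have le2 : expR (2 * `|s * b x|) <= expR (c / 2 * B x).
  rewrite ler_expR normrM (gtr0_norm s0) mulrA.
  by apply: ler_pM => //; [rewrite mulr_ge0// ltW|lra].
have le3 : `|D| * `|C| <= e * 2 ^+ m.
  rewrite -ler_pdivrMl// mulrC.
  apply: (@le_trans _ _ m%:R); first by apply/ltW; exact: truncnS_gt.
  by rewrite -natrX ler_nat ltnW// ltn_expl.
have E0 y : 0 <= expR y := expR_ge0 y.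
have qle : `|q x| <= `|D| * expR (c / 2 * B x).
  by apply: (le_trans (qD x)); rewrite ler_wpM2r// ler_norm.
have vle : v x <= `|C| * expR (- (c * B x)).
  by apply: (le_trans (v_le x)); rewrite ler_wpM2r// ler_norm.
have main : `|sin (s * b x) - series (sin_coeff (s * b x)) m| * `|q x| * v x <=
   expR (c / 2 * B x) / 2 ^+ m * (`|D| * expR (c / 2 * B x)) *
     (`|C| * expR (- (c * B x))).
  apply: ler_pM => //; apply: ler_pM => //; apply: (le_trans le1).
  by rewrite ler_wpM2r// invr_ge0 exprn_ge0.
apply: (le_trans main).
have EE : expR (c / 2 * B x) * expR (c / 2 * B x) * expR (- (c * B x)) = 1.
  by rewrite -!expRD -[RHS]expR0; congr expR; field.
have -> : expR (c / 2 * B x) / 2 ^+ m * (`|D| * expR (c / 2 * B x)) *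
     (`|C| * expR (- (c * B x))) = `|D| * `|C| / 2 ^+ m *
    (expR (c / 2 * B x) * expR (c / 2 * B x) * expR (- (c * B x))) by ring.
by rewrite EE mulr1 ler_pdivrMr ?exprn_gt0.
Qed.

Hypothesis P_separates : forall x y, x <> y ->
  exists b, [/\ P b, continuous b, forall z, `|b z| <= B z & b x <> b y].

Lemma multipliers_separate x y : x <> y -> exists2 h, multipliers h & h x <> h y.
Proof.
move=> /P_separates[b [Pb bc bB bxy]].
(* The second bound brings both arguments into the interval [-1, 1], where the
   sine is injective. *)
pose s := Num.min (c / 4) (1 + `|b x| + `|b y|)^-1.
have d0 : 0 < 1 + `|b x| + `|b y|.
  by have := normr_ge0 (b x); have := normr_ge0 (b y); lra.
have s0 : 0 < s by rewrite /s lt_min invr_gt0 d0 divr_gt0.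
exists (fun z => sin (s * b z)).
  apply: multipliers_sin => //.
  have : s <= c / 4 by rewrite /s ge_min lexx.
  lra.
have sd : s * (1 + `|b x| + `|b y|) <= 1.
  by rewrite -ler_pdivlMr// mul1r /s ge_min lexx orbT.
have small z : `|b z| <= 1 + `|b x| + `|b y| -> s * b z \in `[- (pi / 2), pi / 2].
  move=> bz; rewrite in_itv /= -ler_norml normrM (gtr0_norm s0).
  apply: le_trans (pihalf_ge1 R); apply: le_trans sd.
  by rewrite ler_wpM2l// ltW.
move=> /sin_inj -/(_ (small _ _) (small _ _)) sb; apply: bxy.
apply: (mulfI (lt0r_neq0 s0)); apply: sb.
  by have := normr_ge0 (b y); lra.
by have := normr_ge0 (b x); lra.
Qed.

Hypothesis v_compact : forall e : R, 0 < e -> compact [set x | e <= v x].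

(** The bound on [f] where [v |f| >= e] stands in for membership in the weighted
    space because it passes at once from a complex function to its real and
    imaginary parts. *)
Lemma weighted_density f : continuous f ->
  (forall e : R, 0 < e -> exists n, forall x, e <= v x * `|f x| -> `|f x| <= n) ->
  weighted_closure f.
Proof.
move=> fc fn; apply: weighted_closure_limit => e e0.
have [n0 fn0] := fn _ e0.
pose n := `|n0| + 1; have n_gt0 : 0 < n by rewrite ltr_wpDl.
have fle x : e <= v x * `|f x| -> `|f x| <= n.
  by move=> /fn0 fx; apply: (le_trans fx); rewrite /n; have := ler_norm n0; lra.
pose t x := Num.max (- n) (Num.min n (f x)).
have tn x : `|t x| <= n.
  by rewrite ler_norml le_max lexx ge_max ge_min lexx /= andbT; lra.
have tc : continuous t.
  move=> x.
  apply: (@continuous_max _ _ (fun=> - n) (fun y => Num.min n (f y))).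
    exact: cvg_cst.
  apply: (@continuous_min _ _ (fun=> n) f); first exact: cvg_cst.
  exact: fc.
exists t; last first.
  (* Where [f] differs from [t], [v `|f|] is below [e], and [f - t] is no larger
     than [f]. *)
  move=> x; have [/fle|] := leP e (v x * `|f x|).
    rewrite ler_norml /t => /andP[fn1 fn2].
    by rewrite min_r// max_r// subrr normr0 mul0r ltW.
  move=> /ltW vf; apply: le_trans vf; rewrite mulrC ler_wpM2l//.
  rewrite /t; case: (leP n (f x)) => ?; case: (leP (- n) _) => ?.
  - by rewrite !ger0_norm; lra.
  - lra.
  - by rewrite subrr normr0.
  - by rewrite !ler0_norm; lra.
have [V Vle] := P_weighted (subalgebra_cst algP 1).
have {}Vle x : v x <= V by have := Vle x; rewrite normr1 mul1r.
apply: weighted_closure_limit => d d0.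
pose W := `|V| + 1; have W0 : 0 < W by rewrite ltr_wpDl.
have vW x : v x <= W by have := Vle x; have := ler_norm V; rewrite /W; lra.
have r0 : 0 < d / (2 * n) by rewrite divr_gt0// mulr_gt0.
have [g [Mg gn gK]] := stone_weierstrass multipliers_algebra
  (fun g (Mg : multipliers g) => let: And3 gc _ _ := Mg in gc)
  multipliers_separate tc tn (v_compact r0) (divr_gt0 d0 W0).
exists g => [|x].
  have := Mg => -[_ _ /(_ _ (subalgebra_cst algP 1))].
  by under eq_fun do rewrite mulr1.
have [/gK tg|/ltW vx] := leP (d / (2 * n)) (v x).
  by apply: (le_trans (ler_pM _ _ tg (vW x))) => //; rewrite divfK// gt_eqF.
have tg : `|t x - g x| <= 2 * n.
  by have := ler_normB (t x) (g x); have := tn x; have := gn x; lra.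
apply: (le_trans (ler_pM _ _ tg vx)) => //.
by rewrite mulrC divfK// gt_eqF// mulr_gt0.
Qed.

End WeightedApproximation.

(** * Real and complex scalars *)

Section Scalars.
Variables (R : realType) (k : scalar_kind).
Local Notation K := (scalar_field R k).

Definition embed : R -> K :=
  match k with
  | RealScalars => fun r : R => r
  | ComplexScalars => fun r : R => r%:C%C
  end.

Definition real_part : K -> R :=
  match k with
  | RealScalars => fun z : R => z
  | ComplexScalars => fun z : R[i] => complex.Re z
  end.

Definition imaginary_part : K -> R :=
  match k with
  | RealScalars => fun=> 0
  | ComplexScalars => fun z : R[i] => complex.Im z
  end.

(** The value [0] over the reals makes [scalarE] hold in both cases. *)
Definition imaginary_unit : K :=
  match k with
  | RealScalars => 0 : R
  | ComplexScalars => 'i%C : R[i]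
  end.

End Scalars.

Arguments embed {R k}.
Arguments real_part {R k}.
Arguments imaginary_part {R k}.
Arguments imaginary_unit {R k}.

Section ScalarTheory.
Variables (R : realType) (k : scalar_kind).
Local Notation K := (scalar_field R k).
Implicit Types (z w : K) (r s : R).

Lemma embedD r s : embed (r + s) = embed r + embed s :> K.
Proof. by case: k => //=; rewrite rmorphD. Qed.

Lemma embedM r s : embed (r * s) = embed r * embed s :> K.
Proof. by case: k => //=; rewrite rmorphM. Qed.

Lemma embed0 : embed 0 = 0 :> K.
Proof. by case: k. Qed.

Lemma embedB r s : embed (r - s) = embed r - embed s :> K.
Proof. by case: k => //=; rewrite rmorphB. Qed.

Lemma ltr_embed r s : (embed r < embed s :> K) = (r < s).
Proof. by case: k => //=; rewrite ltcR. Qed.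

Lemma ler_embed r s : (embed r <= embed s :> K) = (r <= s).
Proof. by case: k => //=; rewrite lecR. Qed.

Lemma normr_modulus z : `|z| = embed (modulus z).
Proof. by case: k z. Qed.

Lemma modulus_embed r : modulus (embed r : K) = `|r|.
Proof.
case: k => //=.
by rewrite /ComplexField.Normc.normc /= expr0n addr0 sqrtr_sqr.
Qed.

Lemma modulus_ge0 z : 0 <= modulus z.
Proof. by rewrite -ler_embed -normr_modulus embed0. Qed.

Lemma ler_modulusD z w : modulus (z + w) <= modulus z + modulus w.
Proof. by rewrite -ler_embed embedD -!normr_modulus ler_normD. Qed.

Lemma modulusM z w : modulus (z * w) = modulus z * modulus w.
Proof.
apply/eqP; rewrite eq_le -!ler_embed embedM -!normr_modulus normrM.
by rewrite lexx.
Qed.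

Lemma modulus_conjugate z : modulus (conjugate z) = modulus z.
Proof.
case: k z => //= -[x y].
by rewrite /ComplexField.Normc.normc /= sqrrN.
Qed.

Lemma conjugateB z w : conjugate (z - w) = conjugate z - conjugate w.
Proof. by case: k z w => //= z w; rewrite rmorphB. Qed.

Lemma real_partB z w : real_part (z - w) = real_part z - real_part w.
Proof. by case: k z w => //= -[a b] [c d]. Qed.

Lemma imaginary_partB z w :
  imaginary_part (z - w) = imaginary_part z - imaginary_part w.
Proof. by case: k z w => [z w|[a b] [c d]] //=; rewrite subrr. Qed.

Lemma modulus_ge_real_part z : `|real_part z| <= modulus z.
Proof.
case: k z => //= -[a b]; rewrite /ComplexField.Normc.normc /=.
by rewrite -sqrtr_sqr ler_sqrt ?addr_ge0 ?sqr_ge0// lerDl sqr_ge0.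
Qed.

Lemma modulus_ge_imaginary_part z : `|imaginary_part z| <= modulus z.
Proof.
case: k z => //= [z|[a b]]; first by rewrite normr0.
rewrite /ComplexField.Normc.normc /=.
by rewrite -sqrtr_sqr ler_sqrt ?addr_ge0 ?sqr_ge0// lerDr sqr_ge0.
Qed.

Lemma scalarE z : z = embed (real_part z) + imaginary_unit * embed (imaginary_part z).
Proof.
case: k z => /= [z|z]; first by rewrite mulr0 addr0.
by rewrite -complexE.
Qed.

Lemma modulus_imaginary_unit : modulus (imaginary_unit : K) <= 1.
Proof.
case: k => /=; first by rewrite normr0.
by rewrite /ComplexField.Normc.normc /= expr0n expr1n add0r sqrtr1.
Qed.

(** Over the reals the conjugation is the identity, so the same constant [1/2]
    serves in both cases; this keeps the real parts of the generators among the
    polynomials without a separate treatment of the real case. *)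
Lemma embed_real_part : exists c : K, forall z,
  embed (real_part z) = c * (z + conjugate z).
Proof.
case: k => /=; exists (2^-1); move=> z; first by field.
apply: (mulfI (x := 2)); first by rewrite pnatr_eq0.
rewrite mulrA divff ?pnatr_eq0// mul1r.
by case: z => a b; rewrite mulr_natl mulr2n; simpc.
Qed.

Lemma embed_imaginary_part : exists c : K, forall z,
  embed (imaginary_part z) = c * (z + -1 * conjugate z).
Proof.
case: k => /=; first by exists 0 => z; rewrite mul0r.
exists ((2 * 'i%C)^-1) => z.
have i0 : 2 * 'i%C != 0 :> R[i] by rewrite mulf_neq0 ?pnatr_eq0// neq0Ci.
apply: (mulfI i0); rewrite mulrA divff// mul1r mulN1r.
by case: z => a b; rewrite -mulrA mulr_natl mulr2n; simpc.
Qed.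

Lemma continuous_modulus_contraction (X : topologicalType) (phi : K -> R)
    (f : X -> K) : (forall z w, `|phi z - phi w| <= modulus (z - w)) ->
  continuous f -> continuous (fun x => phi (f x)).
Proof.
move=> phiP fc x; apply/cvgrPdist_lt => e e0.
have e0' : (0 : K) < embed e by rewrite -embed0 ltr_embed.
have /cvgrPdist_lt /(_ _ e0') := fc x.
apply: filterS => y; rewrite normr_modulus ltr_embed.
exact: le_lt_trans.
Qed.

Lemma continuous_conjugate (X : topologicalType) (f : X -> K) :
  continuous f -> continuous (fun x => conjugate (f x)).
Proof.
move=> fc x; apply/cvgrPdist_lt => e e0.
have /cvgrPdist_lt /(_ _ e0) := fc x.
apply: filterS => y; rewrite !normr_modulus.
by rewrite -conjugateB modulus_conjugate.
Qed.

Lemma modulus_contraction z w : `|modulus z - modulus w| <= modulus (z - w).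
Proof.
have := ler_modulusD (z - w) w; have := ler_modulusD (w - z) z.
rewrite !subrK => wz zw.
have : modulus (w - z) = modulus (z - w).
  apply/eqP; rewrite eq_le -!ler_embed -!normr_modulus distrC.
  by rewrite lexx.
by move=> e; rewrite ler_norml; lra.
Qed.

End ScalarTheory.

(** * The polynomial algebra *)

Section PolynomialAlgebra.
Variables (R : realType) (k : scalar_kind) (X : topologicalType).
Local Notation K := (scalar_field R k).
Variables (N : nat) (a : 'I_N -> X -> K).

Lemma polynomial_algebra_ind (Q : set (X -> K)) :
  (forall c, Q (fun=> c)) ->
  (forall f g, Q f -> Q g -> Q (fun x => f x + g x)) ->
  (forall f g, Q f -> Q g -> Q (fun x => f x * g x)) ->
  (forall j, Q (a j)) -> (forall j, Q (fun x => conjugate (a j x))) ->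
  polynomial_algebra a `<=` Q.
Proof.
move=> Qc QD QM Qa Qac _ [p _ <-].
have Qv i : Q (fun x => system_valuation a x i).
  by rewrite /system_valuation; case: (fintype.split i).
under eq_fun do rewrite mpoly.mevalE.
elim: (mpoly.msupp p) => [|m r Qr].
  by under eq_fun do rewrite big_nil; exact: Qc.
under eq_fun do rewrite big_cons.
apply: (QD _ _ _ Qr); apply: (QM); first exact: Qc.
elim: (index_enum _) => [|i s Qs].
  by under eq_fun do rewrite big_nil; exact: Qc.
under eq_fun do rewrite big_cons.
apply: (QM _ _ _ Qs); elim: (mpoly.fun_of_multinom _ _) => [|n IH]; first exact: Qc.
by under eq_fun do rewrite exprS; exact: QM.
Qed.

Lemma polynomial_algebra_cst c : polynomial_algebra a (fun=> c).
Proof.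
exists (mpoly.mpolyC (N + N) c) => //.
by apply/funext => x; rewrite mpoly.mevalC.
Qed.

Lemma polynomial_algebraD f g : polynomial_algebra a f ->
  polynomial_algebra a g -> polynomial_algebra a (fun x => f x + g x).
Proof.
move=> [p _ <-] [q _ <-]; exists (p + q) => //.
by apply/funext => x; rewrite mpoly.mevalD.
Qed.

Lemma polynomial_algebraM f g : polynomial_algebra a f ->
  polynomial_algebra a g -> polynomial_algebra a (fun x => f x * g x).
Proof.
move=> [p _ <-] [q _ <-]; exists (p * q) => //.
by apply/funext => x; rewrite mpoly.mevalM.
Qed.

Lemma polynomial_algebra_gen j : polynomial_algebra a (a j).
Proof.
exists (mpoly.mpolyX _ (mpoly.mnm1 (lshift N j))) => //.
apply/funext => x; rewrite mpoly.mevalXU /system_valuation.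
by rewrite (unsplitK (inl _ j)).
Qed.

Lemma polynomial_algebra_conj j :
  polynomial_algebra a (fun x => conjugate (a j x)).
Proof.
exists (mpoly.mpolyX _ (mpoly.mnm1 (rshift N j))) => //.
apply/funext => x; rewrite mpoly.mevalXU /system_valuation.
by rewrite (unsplitK (inr _ j)).
Qed.

(** Working with the real-valued elements of the algebra, rather than with
    polynomials in the real and imaginary parts, makes the approximants obtained
    below polynomials in the generators by definition. *)
Definition real_polynomials : set (X -> R) :=
  [set h : X -> R | polynomial_algebra a (fun x => embed (h x))].

Lemma real_polynomials_subalgebra : subalgebra real_polynomials.
Proof.
split=> [c|f g Pf Pg|f g Pf Pg]; rewrite /real_polynomials /=.
- exact: polynomial_algebra_cst.
- by under eq_fun do rewrite embedD; exact: polynomial_algebraD.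
- by under eq_fun do rewrite embedM; exact: polynomial_algebraM.
Qed.

Lemma real_part_polynomial j : real_polynomials (fun x => real_part (a j x)).
Proof.
have [c cE] := embed_real_part R k; rewrite /real_polynomials /=.
under eq_fun do rewrite cE.
apply: polynomial_algebraM; first exact: polynomial_algebra_cst.
apply: polynomial_algebraD; first exact: polynomial_algebra_gen.
exact: polynomial_algebra_conj.
Qed.

Lemma imaginary_part_polynomial j :
  real_polynomials (fun x => imaginary_part (a j x)).
Proof.
have [c cE] := embed_imaginary_part R k; rewrite /real_polynomials /=.
under eq_fun do rewrite cE.
apply: polynomial_algebraM; first exact: polynomial_algebra_cst.
apply: polynomial_algebraD; first exact: polynomial_algebra_gen.
apply: polynomial_algebraM; first exact: polynomial_algebra_cst.
exact: polynomial_algebra_conj.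
Qed.

Lemma polynomial_algebra_continuous f : (forall j, continuous (a j)) ->
  polynomial_algebra a f -> continuous f.
Proof.
move=> ac; apply: (polynomial_algebra_ind (Q := fun f => continuous f)).
- by move=> c x; exact: cvg_cst.
- by move=> g h gc hc x; apply: cvgD; [exact: gc|exact: hc].
- by move=> g h gc hc x; apply: cvgM; [exact: gc|exact: hc].
- exact: ac.
- by move=> j; exact: continuous_conjugate.
Qed.

Definition system_size (x : X) : R := \sum_(j < N) modulus (a j x).

Lemma system_size_ge0 x : 0 <= system_size x.
Proof. by apply: sumr_ge0 => j _; exact: modulus_ge0. Qed.

Lemma modulus_le_system_size j x : modulus (a j x) <= system_size x.
Proof.
rewrite /system_size (bigD1 j)//= lerDl sumr_ge0// => i _.
exact: modulus_ge0.
Qed.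

(** The functions with this growth form an algebra, since the exponent [e] may be
    shared between two factors; generators belong to it because
    [e B <= exp(e B)] for [B = system_size a]. *)
Lemma polynomial_algebra_subexponential f : polynomial_algebra a f ->
  forall e : R, 0 < e ->
  exists b, forall x, modulus (f x) <= b * expR (e * system_size x).
Proof.
have E1 (e : R) x : 0 < e -> 1 <= expR (e * system_size x).
  by move=> e0; rewrite -expR0 ler_expR mulr_ge0 ?system_size_ge0// ltW.
have gen j (e : R) : 0 < e ->
    exists b, forall x, modulus (a j x) <= b * expR (e * system_size x).
  move=> e0; exists e^-1 => x; rewrite mulrC ler_pdivlMr//.
  have := expR_ge1Dx (e * system_size x).
  have := ler_wpM2l (ltW e0) (modulus_le_system_size j x).
  by rewrite mulrC; lra.
apply: (polynomial_algebra_ind (Q := fun f => forall e : R, 0 < e ->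
  exists b, forall x, modulus (f x) <= b * expR (e * system_size x))).
- move=> c e e0; exists (modulus c) => x.
  by rewrite ler_peMr ?modulus_ge0// E1.
- move=> g h gS hS e e0; have [b gb] := gS e e0; have [b' hb] := hS e e0.
  exists (b + b') => x; apply: (le_trans (ler_modulusD _ _)).
  by rewrite mulrDl lerD.
- move=> g h gS hS e e0; have e20 : 0 < e / 2 by rewrite divr_gt0.
  have [b gb] := gS _ e20; have [b' hb] := hS _ e20.
  exists (b * b') => x; rewrite modulusM {1}(splitr e) mulrDl expRD mulrACA.
  by apply: ler_pM; rewrite ?modulus_ge0.
- exact: gen.
- by move=> j e /(gen j e)[b ab]; exists b => x; rewrite modulus_conjugate.
Qed.

End PolynomialAlgebra.

(** The product of nonnegative upper semicontinuous functions is upper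
    semicontinuous; here one of them is continuous. *)
Lemma closed_superlevel_mul (R : realType) (X : topologicalType)
    (v g : X -> R) : (forall x, 0 <= v x) -> (forall x, 0 <= g x) ->
  (forall e, 0 < e -> closed [set x | e <= v x]) -> continuous g ->
  forall e, 0 < e -> closed [set x | e <= v x * g x].
Proof.
move=> v0 g0 vcl gc e e0; rewrite -[X in closed X]setCK.
apply: open_closedC; rewrite openE => x /= /negP; rewrite -ltNge => xe.
(* Chosen so that [(v x + d) * (g x + d) <= e]. *)
pose d := Num.min 1 ((e - v x * g x) / (v x + g x + 1)).
have s0 : 0 < v x + g x + 1 by have := v0 x; have := g0 x; lra.
have d0 : 0 < d by rewrite /d lt_min ltr01 divr_gt0// subr_gt0.
have d1 : d <= 1 by rewrite /d ge_min lexx.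
have d2 : d * (v x + g x + 1) <= e - v x * g x.
  by rewrite -ler_pdivlMr// /d ge_min lexx orbT.
have vd0 : 0 < v x + d by have := v0 x; lra.
have : nbhs x (~` [set y | v x + d <= v y]).
  apply: open_nbhs_nbhs; split; first exact: closed_openC (vcl _ vd0).
  by move=> /=; lra.
have /cvgrPdist_lt /(_ _ d0) := gc x; apply: filterS2 => y gy /= /negP vy.
rewrite -ltNge in vy; apply/negP; rewrite -ltNge.
have gy' : g y <= g x + d.
  by move: gy; rewrite ltr_norml => /andP[]; lra.
apply: (@le_lt_trans _ _ (v y * (g x + d))); first by rewrite ler_wpM2l.
have gd0 : 0 < g x + d by have := g0 x; lra.
apply: (@lt_le_trans _ _ ((v x + d) * (g x + d))); first by rewrite ltr_pM2r.
have : d * d <= d * 1 by rewrite ler_wpM2l// ltW.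
have -> : (v x + d) * (g x + d) = v x * g x + d * (v x + g x) + d * d by ring.
move: d2; rewrite mulrDr; lra.
Qed.

Lemma continuous_bounded_on_compact (R : realType) (X : topologicalType)
    (g : X -> R) (A : set X) : continuous g -> compact A ->
  exists n, forall x, A x -> g x <= n.
Proof.
move=> gc cA.
have [M [_ MA]] :=
  compact_bounded (continuous_compact (continuous_subspaceT gc) cA).
exists (M + 1) => x Ax; apply: (le_trans (ler_norm _)).
by apply: (MA (M + 1)); [rewrite ltrDl|exists x].
Qed.

(** * The weighted space *)

Section WeightedSpaceTheory.
Variables (R : realType) (k : scalar_kind) (X : topologicalType).
Local Notation K := (scalar_field R k).
Variable v : X -> R.
Hypothesis v_ge0 : forall x, 0 <= v x.

Lemma C0_bounded_superlevel (f : X -> K) : C0 v f -> forall e : R, 0 < e ->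
  exists n, forall x, e <= v x * modulus (f x) -> modulus (f x) <= n.
Proof.
move=> [fc f0] e e0.
have mc := continuous_modulus_contraction (@modulus_contraction R k) fc.
have [n nb] := continuous_bounded_on_compact mc (f0 e e0).
exists n => x fe; apply: nb => /=.
by rewrite ger0_norm// mulr_ge0 ?modulus_ge0.
Qed.

Lemma compact_superlevel_weight (z : K) : z != 0 -> C0 v (fun=> z) ->
  forall e : R, 0 < e -> compact [set x | e <= v x].
Proof.
move=> z_neq0 [_ z0] e e0.
have z_gt0 : 0 < modulus z.
  rewrite lt_def modulus_ge0 andbT; apply: contra_neq z_neq0 => zz.
  by apply/normr0_eq0; rewrite normr_modulus zz embed0.
have := z0 _ (mulr_gt0 e0 z_gt0).
congr compact; apply/seteqP; split => x /=;
  by rewrite ger0_norm ?mulr_ge0// ?(ltW z_gt0)// ler_pM2r.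
Qed.

Variables (N : nat) (a : 'I_N -> X -> K).

(** The largest of the [|a_j x|] is at least their mean. *)
Lemma weight_decay (C c' : R) (j0 : 'I_N) (x : X) : 0 < C -> 0 < c' ->
  (forall j, v x <= C * expR (- (c' * modulus (a j x)))) ->
  v x <= C * expR (- (c' / N%:R * system_size a x)).
Proof.
move=> C_gt0 c'_gt0 v_le.
have N_gt0 : 0 < N%:R :> R by rewrite ltr0n (leq_ltn_trans _ (ltn_ord j0)).
pose j := [arg max_(i > j0) modulus (a i x)]%O.
have jmax i : modulus (a i x) <= modulus (a j x).
  by rewrite /j; case: arg_maxP => // i' _; apply.
apply: (le_trans (v_le j)); rewrite ler_pM2l// ler_expR lerN2.
rewrite -mulrA ler_pM2l// ler_pdivrMl//.
apply: (@le_trans _ _ (\sum_(i < N) modulus (a j x))); first exact: ler_sum.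
by rewrite sumr_const card_ord mulr_natl.
Qed.

Variables (C c : R).
Hypotheses (C_gt0 : 0 < C) (c_gt0 : 0 < c).
Hypothesis v_le : forall x, v x <= C * expR (- (c * system_size a x)).
Hypothesis a_cont : forall j, continuous (a j).

(** The set where [v |p| >= e] is closed because [v] is upper semicontinuous,
    and lies in a set where [B = system_size a] is bounded because [v |p|] is at
    most a constant times [exp(- c B / 2)]. *)
Lemma polynomial_algebra_C0 : hausdorff_space X ->
  (forall e : R, 0 < e -> compact [set x | e <= v x]) ->
  system_tends_to_infinity a -> polynomial_algebra a `<=` C0 v.
Proof.
move=> X_hausdorff v_compact a_infinity p Dp.
have pc := polynomial_algebra_continuous a_cont Dp.
split => // e e0.
have [b pb] := polynomial_algebra_subexponential Dp
  (divr_gt0 c_gt0 (ltr0Sn R 1)).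
have -> : [set x | e <= `|v x * modulus (p x)|] =
          [set x | e <= v x * modulus (p x)].
  by apply/seteqP; split => x /=; rewrite ger0_norm// mulr_ge0 ?modulus_ge0.
pose r := 2 * (C * `|b|) / (c * e) + 1.
have r_gt0 : 0 < r.
  by rewrite ltr_wpDl// divr_ge0// ?mulr_ge0// ltW.
apply: subclosed_compact (a_infinity _ r_gt0) _.
  apply: closed_superlevel_mul => //.
  - by move=> x; exact: modulus_ge0.
  - by move=> t t0; apply: compact_closed => //; exact: v_compact.
  - exact: continuous_modulus_contraction (@modulus_contraction R k) pc.
move=> x /= ex; rewrite -/(system_size a x) ger0_norm ?system_size_ge0//.
move: (pb x) (v_le x); set B := system_size a x => pbx v_lex.
have E0 y : 0 <= expR y :> R := expR_ge0 y.
have le1 : modulus (p x) <= `|b| * expR (c / 2 * B).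
  by apply: (le_trans pbx); rewrite ler_wpM2r// ler_norm.
have le2 : e <= C * `|b| * expR (- (c / 2 * B)).
  apply: (le_trans ex).
  apply: (le_trans (ler_pM _ _ v_lex le1)); rewrite ?modulus_ge0//.
  rewrite mulrACA -expRD.
  by have -> : - (c * B) + c / 2 * B = - (c / 2 * B) by field.
have le3 : e * (c / 2 * B) <= C * `|b|.
  move: le2; rewrite expRN ler_pdivlMr ?expR_gt0//.
  apply: le_trans; rewrite ler_pM2l//.
  by have := expR_ge1Dx (c / 2 * B); lra.
rewrite /r; apply: (@le_trans _ _ (2 * (C * `|b|) / (c * e))); last by lra.
rewrite ler_pdivlMr ?mulr_gt0//.
have -> : B * (c * e) = 2 * (e * (c / 2 * B)) by field.
by rewrite ler_pM2l.
Qed.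

Lemma real_polynomials_subexponential q : real_polynomials a q ->
  forall e : R, 0 < e ->
  exists b, forall x, `|q x| <= b * expR (e * system_size a x).
Proof.
move=> Pq e e0; have [b qb] := polynomial_algebra_subexponential Pq e0.
by exists b => x; have := qb x; rewrite modulus_embed.
Qed.

Lemma real_polynomials_weighted q : real_polynomials a q ->
  exists b, forall x, `|q x| * v x <= b.
Proof.
move=> Pq; have [b qb] := real_polynomials_subexponential Pq c_gt0.
exists (b * C) => x.
apply: (le_trans (ler_pM _ _ (qb x) (v_le x))) => //.
by rewrite mulrACA -expRD subrr expR0 mulr1.
Qed.

Lemma real_polynomials_separate x y : separates_points a -> x <> y ->
  exists b, [/\ real_polynomials a b, continuous b,
    forall z, `|b z| <= system_size a z & b x <> b y].
Proof.
move=> a_separates /a_separates[j axy].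
have [re_eq|re_neq] := pselect (real_part (a j x) = real_part (a j y)).
  exists (fun z => imaginary_part (a j z)); split.
  - exact: imaginary_part_polynomial.
  - apply: continuous_modulus_contraction => // z w.
    by rewrite -imaginary_partB modulus_ge_imaginary_part.
  - move=> z; apply: (le_trans (modulus_ge_imaginary_part _)).
    exact: modulus_le_system_size.
  - move=> im_eq; apply: axy.
    by rewrite (scalarE (a j x)) re_eq im_eq -scalarE.
exists (fun z => real_part (a j z)); split => //.
- exact: real_part_polynomial.
- apply: continuous_modulus_contraction => // z w.
  by rewrite -real_partB modulus_ge_real_part.
- move=> z; apply: (le_trans (modulus_ge_real_part _)).
  exact: modulus_le_system_size.
Qed.

(** Meant for [phi] the real or the imaginary part. *)
Lemma real_component_density (f : X -> K) (phi : K -> R) :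
  separates_points a -> (forall e : R, 0 < e -> compact [set x | e <= v x]) ->
  (forall z w, `|phi z - phi w| <= modulus (z - w)) ->
  (forall z, `|phi z| <= modulus z) -> C0 v f ->
  weighted_closure v (real_polynomials a) (fun x => phi (f x)).
Proof.
move=> a_separates v_compact phi_lip phi_le Cf.
apply: (weighted_density v_ge0 (real_polynomials_subalgebra a)
  real_polynomials_weighted c_gt0 v_le real_polynomials_subexponential
  (fun x y => real_polynomials_separate a_separates) v_compact).
  by apply: continuous_modulus_contraction phi_lip _; case: Cf.
move=> t t0; have [n fn] := C0_bounded_superlevel Cf t0.
exists n => x tx; apply: (le_trans (phi_le _)); apply: fn.
by apply: (le_trans tx); rewrite ler_wpM2l.
Qed.

End WeightedSpaceTheory.

Theorem theorem5p1 (R : realType) (k : scalar_kind) (X : topologicalType)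
    (X_locally_compact : locally_compact [set: X])
    (X_completely_regular : completely_regular_space X)
    (X_hausdorff : hausdorff_space X)
    (v : X -> R) (v_ge0 : forall x : X, 0 <= v x)
    (N : nat) (a : 'I_N -> X -> scalar_field R k)
    (a_C0 : forall j : 'I_N, C0 v (a j))
    (a_constant : exists (j : 'I_N) (c : scalar_field R k),
        c <> 0 /\ forall x : X, a j x = c)
    (a_separates : separates_points a)
    (a_infinity : system_tends_to_infinity a)
    (C c' : R) (C_gt0 : 0 < C) (c'_gt0 : 0 < c')
    (v_le : forall (x : X) (j : 'I_N),
        v x <= C * expR (- (c' * modulus (a j x)))) :
  dense_in_C0 v (polynomial_algebra a).
Proof.
have [j0 [z [/eqP z_neq0 a_j0]]] := a_constant.
have N_gt0 : 0 < N%:R :> R by rewrite ltr0n (leq_ltn_trans _ (ltn_ord j0)).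
have c_gt0 : 0 < c' / N%:R by rewrite divr_gt0.
have v_decay x : v x <= C * expR (- (c' / N%:R * system_size a x)).
  exact: weight_decay j0 x C_gt0 c'_gt0 (v_le x).
have v_compact : forall e : R, 0 < e -> compact [set x | e <= v x].
  apply: (compact_superlevel_weight v_ge0 z_neq0).
  by have := a_C0 j0; have -> : a j0 = fun=> z by apply/funext.
have a_cont j : continuous (a j) by have [] := a_C0 j.
split.
  exact: (polynomial_algebra_C0 v_ge0 C_gt0 c_gt0 v_decay).
move=> f Cf e e0; have e40 : 0 < e / 4 by rewrite divr_gt0.
have density phi := real_component_density v_ge0 c_gt0 v_decay a_cont
  (f := f) (phi := phi) a_separates v_compact.
have [p Pp fp] : exists2 p, real_polynomials a p &
    forall x, `|real_part (f x) - p x| * v x <= e / 4.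
  apply: density e40 => // [y w|y]; last exact: modulus_ge_real_part.
  by rewrite -real_partB modulus_ge_real_part.
have [q Pq fq] : exists2 q, real_polynomials a q &
    forall x, `|imaginary_part (f x) - q x| * v x <= e / 4.
  apply: density e40 => // [y w|y]; last exact: modulus_ge_imaginary_part.
  by rewrite -imaginary_partB modulus_ge_imaginary_part.
exists (fun x => embed (p x) + imaginary_unit * embed (q x)).
  apply: polynomial_algebraD => //; apply: polynomial_algebraM => //.
  exact: polynomial_algebra_cst.
apply: (@le_lt_trans _ _ (e / 2)%:E); last by rewrite lte_fin; lra.
apply: ge_ereal_sup => _ [x _ <-]; rewrite lee_fin /=.
have -> : f x - (embed (p x) + imaginary_unit * embed (q x)) =
    embed (real_part (f x) - p x) +
    imaginary_unit * embed (imaginary_part (f x) - q x).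
  by rewrite {1}(scalarE (f x)) !embedB mulrBr opprD addrACA.
apply: (le_trans (ler_wpM2r (v_ge0 x) (ler_modulusD _ _))).
rewrite modulusM !modulus_embed mulrDl.
have : modulus (imaginary_unit : scalar_field R k) *
    `|imaginary_part (f x) - q x| * v x <= `|imaginary_part (f x) - q x| * v x.
  by rewrite -mulrA ler_piMl ?mulr_ge0// modulus_imaginary_unit.
by have := fp x; have := fq x; lra.
Qed.
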